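(* Let $\Psi$ be a commuting interaction on a finite graph $\Lambda$ with Hamiltonian $H=\sum_{Z\subset\Lambda}\Psi(Z)$, and assume the spectrum of $H$ has a gap $g>0$ above the ground state energy $E_0$: $E_0\in\sigma(H)$, $E_0<\sigma(H)\setminus\{E_0\}$ and $\mathrm{dist}(\{E_0\},\sigma(H)\setminus\{E_0\})\ge g$. Let $P_0$ be the spectral projection onto the eigenvalue $E_0$ and $\rho_0$ any ground state, i.e. a density matrix with $\rho_0=P_0\rho_0P_0$. For disjoint $X,Y\subset\Lambda$, $A\in\mathcal{A}_X$, $B\in\mathcal{A}_Y$, write $r=\mathrm{dist}(X,Y)$ and $$\mathcal{C}=\Big|\mathrm{tr}(\rho_0AB)-\tfrac12\big(\mathrm{tr}(\rho_0AP_0B)+\mathrm{tr}(\rho_0BP_0A)\big)\Big|.$$ (a) If $\|\Psi\|_{F_\alpha}<\infty$ for some $\alpha>0$, where $F_\alpha(r)=(1+r)^{-\alpha}$, then for all such $X,Y,A,B$, $$\mathcal{C}\le 8\,\|A\|\,\|B\|\,|X|\,|Y|\,\|\rho_0\|_1\Big(\sqrt{\tfrac{\alpha}{\pi}}\,\frac{\|\Psi\|_{F_\alpha}}{g}+1\Big)\ln(1+r)\,F_\alpha(r).$$ (b) Suppose $\Lambda$ is a $(\kappa,D)$-regular graph and $\|\Psi\|_{F_{b,p}}<\infty$ for some $b>\tilde b>0$ and $p\in(0,1]$, where $F_{b,p}(r)=e^{-br^p}$. Then there is a constant $C$ depending only on $b,\tilde b$ (and $p,\kappa,D$) such that for all such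 $X,Y,A,B$, $$\mathcal{C}\le\|A\|\,\|B\|\,\min\{|X|,|Y|\}\,\|\rho_0\|_1\Big(\frac{C\,\|\Psi\|_{F_{b,p}}}{g}+1\Big)F_{\tilde b,p}(r).$$
   Context: $\Lambda$ has graph distance $d$; it is $(\kappa,D)$-regular if $|\{z:d(x,z)\le r\}|\le(1+\kappa)r^D$ for all $x$ and $r\in\mathbb{N}_{>0}$. Each site carries $\mathbb{C}^q$, $\mathcal{A}_Z=\mathcal{B}(\bigotimes_{x\in Z}\mathbb{C}^q)$ embedded in $\mathcal{A}_\Lambda$ via $A\mapsto A\otimes\mathbf{1}$. An interaction assigns to each $Z\subset\Lambda$ a self-adjoint $\Psi(Z)\in\mathcal{A}_Z$; commuting means $[\Psi(Z),\Psi(Z')]=0$ for all $Z,Z'$. $\|\Psi\|_F=\sup_{x,y\in\Lambda}\sum_{Z\ni x,y}\|\Psi(Z)\|/F(d(x,y))$. $\|\cdot\|_1$ is the trace norm. *)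

(* Defs.v *)
From HB Require Import structures.
From mathcomp Require Import all_boot all_order all_algebra.
From mathcomp Require Import complex.
From mathcomp Require Import boolp classical_sets reals.
From mathcomp.analysis Require Import sequences exp trigo.

Set Implicit Arguments.
Unset Strict Implicit.
Unset Printing Implicit Defensive.

Import Order.TTheory GRing.Theory Num.Theory.
Local Open Scope ring_scope.
Local Open Scope classical_set_scope.

Definition undirected (T : finType) (e : rel T) : Prop := symmetric e.

Definition connected_graph (T : finType) (e : rel T) : Prop :=
  forall x y : T, connect e x y.

Fixpoint reach (T : finType) (e : rel T) (n : nat) (x : T) : {set T} :=
  match n with
  | 0 => [set x]
  | n'.+1 => let S := reach e n' x in S :|: [set z | [exists y in S, e y z]]
  end.

(* graph distance d(x,y): the least n such that y is reached from x in n
   steps (on a connected graph this is always < #|T|) *)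
Definition gdist (T : finType) (e : rel T) (x y : T) : nat :=
  find (fun n => y \in reach e n x) (iota 0 #|T|).

Definition setdist (T : finType) (e : rel T) (X Y : {set T}) : nat :=
  \big[minn/#|T|]_(x in X) \big[minn/#|T|]_(y in Y) gdist e x y.

Definition kD_regular (R : realType) (T : finType) (e : rel T) (kappa D : R) : Prop :=
  forall (x : T) (r : nat), (0 < r)%N ->
    (#|[set z | (gdist e x z <= r)%N]|%:R <= (1 + kappa) * (r%:R `^ D) :> R).

(* Quantum spin system: each site carries C^q; the Hilbert space       *)
(* (x)_{x in T} C^q has the product basis indexed by configurations     *)
(* T -> 'I_q; operators are square complex matrices on that basis.     *)

Definition conf (T : finType) (q : nat) := {ffun T -> 'I_q}.
Definition dimH (T : finType) (q : nat) : nat := #|{: conf T q}|.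
Definition op (R : realType) (T : finType) (q : nat) := 'M[R[i]]_(dimH T q).

Definition cfg (T : finType) (q : nat) (i : 'I_(dimH T q)) : conf T q :=
  enum_val i.

(* A belongs to A_X embedded in A_Lambda as A (x) 1: its matrix entries are
   those of an operator on (x)_{x in X} C^q tensored with the identity on
   the complement of X *)
Definition local (R : realType) (T : finType) (q : nat) (X : {set T})
    (A : op R T q) : Prop :=
  exists f : conf T q -> conf T q -> R[i],
    (forall s t s' t' : conf T q,
        {in X, s =1 s'} -> {in X, t =1 t'} -> f s t = f s' t') /\
    forall i j : 'I_(dimH T q),
      A i j = if [forall x in ~: X, cfg i x == cfg j x]
              then f (cfg i) (cfg j) else 0.

Definition adjmx (R : realType) (m n : nat) (A : 'M[R[i]]_(m, n)) : 'M[R[i]]_(n, m) :=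
  (map_mx Num.conj A)^T.

Definition selfadj (R : realType) (n : nat) (A : 'M[R[i]]_n) : Prop :=
  adjmx A = A.

Definition psd (R : realType) (n : nat) (A : 'M[R[i]]_n) : Prop :=
  selfadj A /\ forall v : 'cV[R[i]]_n, 0 <= (adjmx v *m A *m v) 0 0.

Definition density (R : realType) (n : nat) (rho : 'M[R[i]]_n) : Prop :=
  psd rho /\ \tr rho = 1.

Definition cabs (R : realType) (z : R[i]) : R :=
  Num.sqrt (complex.Re z ^+ 2 + complex.Im z ^+ 2).

Definition vnorm (R : realType) (n : nat) (v : 'cV[R[i]]_n) : R :=
  Num.sqrt (\sum_(k < n) cabs (v k 0) ^+ 2).

Definition opnorm (R : realType) (n : nat) (A : 'M[R[i]]_n) : R :=
  sup [set vnorm (A *m v) | v in [set v : 'cV[R[i]]_n | vnorm v <= 1]].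

(* trace norm ||rho||_1 = tr |rho|, |rho| = sqrt(rho^* rho) the unique
   positive semidefinite square root of rho^* rho *)
Definition trnorm (R : realType) (n : nat) (rho : 'M[R[i]]_n) : R :=
  sup [set complex.Re (\tr S) |
        S in [set S : 'M[R[i]]_n | psd S /\ S *m S = adjmx rho *m rho]].

Definition interaction (R : realType) (T : finType) (q : nat)
    (Psi : {set T} -> op R T q) : Prop :=
  forall Z : {set T}, selfadj (Psi Z) /\ local Z (Psi Z).

Definition commuting (R : realType) (T : finType) (q : nat)
    (Psi : {set T} -> op R T q) : Prop :=
  forall Z Z' : {set T}, Psi Z *m Psi Z' = Psi Z' *m Psi Z.

Definition hamiltonian (R : realType) (T : finType) (q : nat)
    (Psi : {set T} -> op R T q) : op R T q :=
  \sum_(Z : {set T}) Psi Z.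

(* ||Psi||_F = sup_{x,y} sum_{Z ni x,y} ||Psi(Z)|| / F(d(x,y))
   (a maximum over the finite vertex set; all terms are >= 0) *)
Definition normF (R : realType) (T : finType) (e : rel T) (q : nat)
    (F : nat -> R) (Psi : {set T} -> op R T q) : R :=
  \big[Num.max/0]_(x : T) \big[Num.max/0]_(y : T)
     ((\sum_(Z : {set T} | (x \in Z) && (y \in Z)) opnorm (Psi Z))
        / F (gdist e x y)).

Definition F_pow (R : realType) (alpha : R) (r : nat) : R :=
  (1 + r%:R) `^ (- alpha).

Definition F_exp (R : realType) (b p : R) (r : nat) : R :=
  expR (- (b * (r%:R `^ p))).

Definition gapped (R : realType) (n : nat) (H : 'M[R[i]]_n) (E0 g : R) : Prop :=
  eigenvalue H (E0%:C)%C /\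
  forall lam : R[i], eigenvalue H lam -> lam != (E0%:C)%C ->
    (E0%:C)%C < lam /\ g <= cabs (lam - (E0%:C)%C).

Definition spec_proj (R : realType) (n : nat) (H : 'M[R[i]]_n) (E0 : R)
    (P0 : 'M[R[i]]_n) : Prop :=
  P0 *m P0 = P0 /\ selfadj P0 /\
  forall v : 'cV[R[i]]_n, P0 *m v = v <-> H *m v = (E0%:C)%C *: v.

Definition ground_state (R : realType) (n : nat) (P0 rho : 'M[R[i]]_n) : Prop :=
  density rho /\ rho = P0 *m rho *m P0.

Definition corr (R : realType) (n : nat) (rho P0 A B : 'M[R[i]]_n) : R :=
  cabs (\tr (rho *m A *m B)
        - 2^-1 * (\tr (rho *m A *m P0 *m B) + \tr (rho *m B *m P0 *m A))).

(* Main.v *)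
(* Split H = K + V, where V collects the terms meeting both X and Y.  All terms
   commute, so the nested commutators of K with A only involve terms disjoint
   from Y, hence commute with B; the same holds for p(ad K) A for every
   polynomial p.  Since V commutes with H and ||V|| <= W, the sum of the norms of
   its terms, K has the band P0 of width at most 2W, separated from the rest of
   its spectrum by at least g - 2W.  If 4W < g, a polynomial p interpolating the
   sign function cut off at g/2 kills P0 A P0 and multiplies the two cross terms
   by -1 and 1, so that tr (rho0 [p(ad K) A, B]) = 0 says that the correlation
   vanishes exactly.  If 4W >= g, the trivial bound ||A|| ||B|| is at most
   4W/g ||A|| ||B||, and W is bounded through ||Psi||_F.  No filter function in
   time is needed. *)

Require Import Defs.
From HB Require Import structures.
From mathcomp Require Import all_boot all_order all_algebra.
From mathcomp Require Import ring lra.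
From mathcomp Require Import complex.
From mathcomp Require Import boolp classical_sets reals.
From mathcomp.analysis Require Import sequences exp trigo.
Import Order.TTheory GRing.Theory Num.Theory.
Local Open Scope ring_scope.
Local Open Scope sesquilinear_scope.

Set Implicit Arguments.
Unset Strict Implicit.
Unset Printing Implicit Defensive.

(** * Commuting perturbations of a gapped matrix *)

(** Newton's scheme: each new value is corrected by a multiple of the product vanishing at the
    earlier points. Polynomials thereby realise any function of finitely many frequencies. *)
Lemma poly_interpolation (F : fieldType) (s : seq F) (f : F -> F) :
  exists p : {poly F}, {in s, forall x, p.[x] = f x}.
Proof.
elim: s => [|x s [p ps]]; first by exists 0.
have [xs|xs] := boolP (x \in s).
  by exists p => y; rewrite inE => /orP[/eqP->|]; exact: ps.
pose w : {poly F} := \prod_(y <- s) ('X - y%:P).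
have wx : w.[x] != 0 by rewrite -[_ == 0]/(root w x) root_prod_XsubC.
exists (p + ((f x - p.[x]) / w.[x]) *: w) => y.
rewrite inE hornerD hornerZ => /orP[/eqP->|ys].
  by rewrite divfK // addrC subrK.
have -> : w.[y] = 0 by apply/rootP; rewrite root_prod_XsubC.
by rewrite mulr0 addr0 ps.
Qed.

(** Commuting matrices are triangular in a common orthonormal basis, and a Hermitian triangular
    matrix is diagonal. *)
Lemma hermitian_codiagonalization (C : numClosedFieldType) n (A B : 'M[C]_n) :
  A^t* = A -> B^t* = B -> A *m B = B *m A ->
  exists (U : 'M[C]_n) (a b : 'rV[C]_n), [/\ U \is unitarymx,
    A = U^t* *m diag_mx a *m U & B = U^t* *m diag_mx b *m U].
Proof.
move=> hA hB /cotrigonalization2[U uU /andP[tA tB]].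
have UU : U^t* *m U = 1%:M by apply/mulmx1C/unitarymxP.
suff diag (M : 'M[C]_n) : M^t* = M -> similar_trig U M ->
    exists m : 'rV_n, M = U^t* *m diag_mx m *m U.
  have [a eA] := diag _ hA tA; have [b eB] := diag _ hB tB.
  by exists U, a, b.
move=> hM; rewrite /similar_to /= conjymx // => tM.
pose N := U *m M *m U^t*.
have hN : N^t* = N.
  by rewrite /N !trmx_mul !map_mxM trmxCK hM mulmxA.
have tN : is_trig_mx N := tM.
have dN i j : i != j -> N i j = 0.
  move=> ij; case: (ltngtP i j) => [lt_ij|lt_ji|/ord_inj eij].
  - exact: (is_trig_mxP tN).
  - by rewrite -hN 2!mxE (is_trig_mxP tN _ _ lt_ji) conjC0.
  - by rewrite eij eqxx in ij.
exists (\row_i N i i).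
have -> : diag_mx (\row_i N i i) = N.
  by apply/matrixP => i j; rewrite 2!mxE; case: eqVneq => [->|/dN->].
by rewrite /N !mulmxA UU mul1mx -mulmxA UU mulmx1.
Qed.

(* The polynomials in [ad K] applied to [A] act entrywise in an eigenbasis of
   [K]; they stay in the commutant of [L] and [B] because, there, [ad K]
   coincides with [ad (K - L)], and [K - L] lies in that commutant. *)
Lemma frequency_filter (C : numClosedFieldType) n (K L A B U : 'M[C]_n)
    (k : 'rV[C]_n) (p : {poly C}) :
  U \is unitarymx -> K = U^t* *m diag_mx k *m U ->
  L *m A = A *m L -> B *m A = A *m B ->
  L *m K = K *m L -> B *m (K - L) = (K - L) *m B ->
  exists M : 'M[C]_n, B *m M = M *m B /\
    forall i j, (U *m M *m U^t*) i j =
      p.[k 0 i - k 0 j] * (U *m A *m U^t*) i j.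
Proof.
move=> uU eK LA BA LK BK.
suff [M [LM BM eM]] : exists M : 'M[C]_n, [/\ L *m M = M *m L,
    B *m M = M *m B & forall i j, (U *m M *m U^t*) i j =
      p.[k 0 i - k 0 j] * (U *m A *m U^t*) i j] by exists M.
elim/poly_ind: p => [|p c [M [LM BM eM]]].
  exists 0; split; rewrite ?mulmx0 ?mul0mx // => i j.
  by rewrite horner0 mul0r mxE.
have UK : U *m K = diag_mx k *m U.
  by rewrite eK !mulmxA (unitarymxP uU) mul1mx.
have KU : K *m U^t* = U^t* *m diag_mx k.
  by rewrite eK -!mulmxA (unitarymxP uU) mulmx1.
have adE : K *m M - M *m K = (K - L) *m M - M *m (K - L).
  by rewrite mulmxBl mulmxBr LM opprB addrA subrK.
(* Passing from [p] to [p * 'X + c] applies [ad K] once more and adds [c *: A]; in the eigenbasis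
   [ad K] multiplies the entry at [i], [j] by [k 0 i - k 0 j]. *)
exists (K *m M - M *m K + c *: A); split.
- rewrite mulmxDr mulmxDl -scalemxAr -scalemxAl LA; congr (_ + _).
  by rewrite mulmxBr mulmxBl !mulmxA LK LM -!mulmxA LK LM.
- rewrite mulmxDr mulmxDl -scalemxAr -scalemxAl BA adE; congr (_ + _).
  move: (K - L) BK => G BG.
  by rewrite mulmxBr mulmxBl !mulmxA BG BM -!mulmxA BG BM.
move=> i j; rewrite hornerMXaddC.
have -> : U *m (K *m M - M *m K + c *: A) *m U^t* =
    diag_mx k *m (U *m M *m U^t*) - (U *m M *m U^t*) *m diag_mx k
    + c *: (U *m A *m U^t*).
  rewrite mulmxDr mulmxDl mulmxBr mulmxBl -scalemxAr -scalemxAl !mulmxA UK.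
  by rewrite -(mulmxA _ K) KU !mulmxA.
rewrite mul_diag_mx mul_mx_diag.
move: (U *m M *m U^t*) (U *m A *m U^t*) (eM i j) => N A' eN.
by rewrite !mxE eN; ring.
Qed.

(* Meant for [phi] the sign function cut off at half the gap: the frequencies of
   [A] between the band [P] and its complement become signs, those inside the
   band are killed. *)
Lemma clustering_of_commuting_filter (C : numClosedFieldType) n
    (A B M P rho U : 'M[C]_n) (k : 'rV[C]_n) (low : pred 'I_n) (phi : C -> C) :
  U \is unitarymx ->
  P = U^t* *m diag_mx (\row_i (low i)%:R) *m U -> rho = P *m rho *m P ->
  B *m M = M *m B ->
  (forall i j, (U *m M *m U^t*) i j =
      phi (k 0 i - k 0 j) * (U *m A *m U^t*) i j) ->
  (forall i j, low i -> low j -> phi (k 0 i - k 0 j) = 0) ->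
  (forall i j, ~~ low i -> low j -> phi (k 0 i - k 0 j) = 1) ->
  (forall i j, low i -> ~~ low j -> phi (k 0 i - k 0 j) = -1) ->
  \tr (rho *m A *m (1%:M - P) *m B) + \tr (rho *m B *m (1%:M - P) *m A) = 0.
Proof.
move=> uU eP erho BM eM ll hl lh.
have UU : U^t* *m U = 1%:M by apply/mulmx1C/unitarymxP.
pose D (b : pred 'I_n) : 'M[C]_n := diag_mx (\row_i (b i)%:R).
have DXD b c X i j : (D b *m X *m D c) i j = (b i)%:R * X i j * (c j)%:R.
  by rewrite mul_mx_diag mul_diag_mx !mxE.
have sandwich (E F X : 'M[C]_n) :
    (U^t* *m E *m U) *m X *m (U^t* *m F *m U) =
    U^t* *m (E *m (U *m X *m U^t*) *m F) *m U by rewrite !mulmxA.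
rewrite -/(D low) in eP.
have eQ : 1%:M - P = U^t* *m D (predC low) *m U.
  rewrite eP -{1}UU -{1}[U^t*]mulmx1 -mulmxBl -mulmxBr.
  congr (_ *m _ *m _); apply/matrixP => i j; rewrite !mxE /=.
  by case: (low i); case: (i == j); rewrite ?subrr ?subr0 ?mulr0n.
have PMP : P *m M *m P = 0.
  rewrite eP sandwich.
  suff -> : D low *m (U *m M *m U^t*) *m D low = 0 by rewrite mulmx0 mul0mx.
  apply/matrixP => i j; rewrite DXD eM [RHS]mxE.
  case Hi: (low i); last by rewrite /= !mul0r.
  case Hj: (low j); last by rewrite /= mulr0.
  by rewrite ll // mul0r mulr0 mul0r.
have PMQ : P *m M *m (1%:M - P) = - (P *m A *m (1%:M - P)).
  rewrite eQ eP !sandwich -mulNmx -mulmxN; congr (_ *m _ *m _).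
  apply/matrixP => i j; rewrite DXD eM [RHS]mxE DXD /=.
  case Hi: (low i); last by rewrite /= !mul0r oppr0.
  case Hj: (low j); first by rewrite /= !mulr0 oppr0.
  by rewrite lh ?Hj // mulN1r mulrN mulNr.
have QMP : (1%:M - P) *m M *m P = (1%:M - P) *m A *m P.
  rewrite eQ eP !sandwich; congr (_ *m _ *m _).
  apply/matrixP => i j; rewrite !DXD eM /=.
  case Hi: (low i); first by rewrite /= !mul0r.
  case Hj: (low j); last by rewrite /= !mulr0.
  by rewrite hl ?Hi /= ?mul1r.
have PP : P *m P = P.
  rewrite -{1}[P]mulmx1 eP sandwich mulmx1 (unitarymxP uU).
  congr (_ *m _ *m _); apply/matrixP => i j; rewrite DXD !mxE.
  by case: eqVneq => [->|]; case: (low _); rewrite /= ?mulr0 ?mul0r ?mul1r ?mulr1.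
have rhoP : rho *m P = rho by rewrite erho -mulmxA PP.
have Prho : P *m rho = rho by rewrite erho !mulmxA PP.
have rhoM : rho *m M = - (rho *m A *m (1%:M - P)).
  transitivity (rho *m (P *m M *m P + P *m M *m (1%:M - P))).
    by rewrite -mulmxDr subrKC mulmx1 mulmxA rhoP.
  by rewrite PMP PMQ add0r mulmxN !mulmxA rhoP.
have Mrho : M *m rho = (1%:M - P) *m A *m rho.
  transitivity ((P *m M *m P + (1%:M - P) *m M *m P) *m rho).
    by rewrite -2!mulmxDl subrKC mul1mx -mulmxA Prho.
  by rewrite PMP QMP add0r -mulmxA Prho.
(* Cyclicity of the trace combined with [BM]. Inserting [rhoM] and [Mrho] turns this into the
   cancellation of the two cross terms. *)
have : \tr (rho *m M *m B) = \tr (M *m rho *m B).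
  by rewrite -mulmxA -BM mulmxA mxtrace_mulC !mulmxA.
rewrite rhoM Mrho mulNmx raddfN /= => /eqP; rewrite eqr_oppLR => /eqP ->.
by rewrite -!mulmxA mxtrace_mulC -!mulmxA mxtrace_mulC -!mulmxA addNr.
Qed.

(** * Operator and trace norms *)

Lemma adjmxE (R : realType) m n (A : 'M[R[i]]_(m, n)) : adjmx A = A^t*.
Proof. by apply/matrixP => i j; rewrite !mxE. Qed.

Lemma cabsE (R : realType) (z : R[i]) : (cabs z)%:C%C = `|z|.
Proof. by rewrite normc_def. Qed.

Lemma cabs_ge0 (R : realType) (z : R[i]) : 0 <= cabs z.
Proof. exact: sqrtr_ge0. Qed.

Lemma cabsM (R : realType) (z w : R[i]) : cabs (z * w) = cabs z * cabs w.
Proof. by apply: complexI; rewrite cabsE normrM rmorphM /= !cabsE. Qed.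

Lemma ler_cabsD (R : realType) (z w : R[i]) : cabs (z + w) <= cabs z + cabs w.
Proof. by rewrite -lecR rmorphD /= !cabsE ler_normD. Qed.

Lemma ler_cabs_sum (R : realType) (I : Type) (r : seq I) (P : pred I) (f : I -> R[i]) :
  cabs (\sum_(i <- r | P i) f i) <= \sum_(i <- r | P i) cabs (f i).
Proof.
rewrite -lecR rmorph_sum /= cabsE [leRHS](eq_bigr (fun i => `|f i|)).
  exact: ler_norm_sum.
by move=> i _; rewrite cabsE.
Qed.

Lemma vnorm_ge0 (R : realType) n (v : 'cV[R[i]]_n) : 0 <= vnorm v.
Proof. exact: sqrtr_ge0. Qed.

Lemma sqr_vnorm (R : realType) n (v : 'cV[R[i]]_n) :
  vnorm v ^+ 2 = \sum_(k < n) cabs (v k 0) ^+ 2.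
Proof. by rewrite sqr_sqrtr // sumr_ge0 // => k _; apply: sqr_ge0. Qed.

Lemma vnorm_dot (R : realType) n (v : 'cV[R[i]]_n) :
  (vnorm v ^+ 2)%:C%C = (v^t* *m v) 0 0.
Proof.
rewrite sqr_vnorm rmorph_sum mxE; apply: eq_bigr => k _.
by rewrite rmorphXn /= cabsE normCK !mxE mulrC.
Qed.

Lemma vnorm_unitary (R : realType) n (U : 'M[R[i]]_n) (v : 'cV[R[i]]_n) :
  U \is unitarymx -> vnorm (U *m v) = vnorm v.
Proof.
move=> uU; apply/eqP; rewrite -(eqrXn2 (n := 2)) ?vnorm_ge0 //; apply/eqP.
apply: complexI; rewrite !vnorm_dot trmx_mul map_mxM -mulmxA (mulmxA _ U).
by rewrite (mulmx1C (unitarymxP uU)) mul1mx.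
Qed.

Lemma cabs_le_vnorm (R : realType) n (v : 'cV[R[i]]_n) k : cabs (v k 0) <= vnorm v.
Proof.
rewrite -(ler_pXn2r (n := 2)) ?nnegrE ?cabs_ge0 ?vnorm_ge0 //.
rewrite sqr_vnorm (bigD1 k) //= lerDl sumr_ge0 // => j _; exact: sqr_ge0.
Qed.

Lemma vnorm_scale (R : realType) n (c : R) (v : 'cV[R[i]]_n) :
  0 <= c -> vnorm (c%:C%C *: v) = c * vnorm v.
Proof.
move=> c0; apply/eqP; rewrite -(eqrXn2 (n := 2)) ?mulr_ge0 ?vnorm_ge0 //; apply/eqP.
rewrite exprMn !sqr_vnorm mulr_sumr; apply: eq_bigr => k _.
rewrite mxE cabsM exprMn; congr (_ ^+ 2 * _).
by apply: complexI; rewrite cabsE ger0_norm // ler0c.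
Qed.

Lemma vnorm_eq0 (R : realType) n (v : 'cV[R[i]]_n) : vnorm v = 0 -> v = 0.
Proof.
move=> v0; apply/matrixP => k j; rewrite ord1 mxE; apply/eqP.
rewrite -normr_eq0 -cabsE; have := cabs_le_vnorm v k; rewrite v0 => le0.
by rewrite (_ : cabs _ = 0) //; apply/eqP; rewrite eq_le le0 cabs_ge0.
Qed.

(** A supremum takes a default value unless the set is nonempty and bounded, so the upper bound
    property of [opnorm] rests on this. *)
Lemma opnorm_has_sup (R : realType) n (A : 'M[R[i]]_n) :
  has_sup [set vnorm (A *m v) | v in [set v : 'cV[R[i]]_n | vnorm v <= 1]]%classic.
Proof.
split.
  exists (vnorm (A *m 0)), 0 => //=; rewrite (_ : vnorm 0 = 0) ?ler01 //.
  rewrite /vnorm big1 ?sqrtr0 // => k _; rewrite mxE.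
  by rewrite (_ : cabs 0 = 0) ?expr0n //; apply: complexI; rewrite cabsE normr0.
(* Coordinates of [v] have modulus at most 1, so the coordinates of [A *m v] are bounded by the
   absolute row sums of [A]. *)
exists (Num.sqrt (\sum_k (\sum_j cabs (A k j)) ^+ 2)) => _ [v /= v1 <-].
rewrite /vnorm; apply: ler_wsqrtr; apply: ler_sum => k _.
rewrite ler_pXn2r ?nnegrE ?cabs_ge0 ?sumr_ge0 //; last first.
  by move=> j _; exact: cabs_ge0.
rewrite mxE; apply: le_trans (ler_cabs_sum _ _ _) _; apply: ler_sum => j _.
rewrite cabsM ler_piMr ?cabs_ge0 //; exact: le_trans (cabs_le_vnorm _ _) v1.
Qed.

Lemma opnorm_ge0 (R : realType) n (A : 'M[R[i]]_n) : 0 <= opnorm A.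
Proof.
have [[x [v v1 vx]] ub] := opnorm_has_sup A.
apply: le_trans (vnorm_ge0 (A *m v)) _.
by apply: sup_upper_bound; [exact: opnorm_has_sup | exists v].
Qed.

Lemma vnorm_mulmx_le (R : realType) n (A : 'M[R[i]]_n) (v : 'cV[R[i]]_n) :
  vnorm (A *m v) <= opnorm A * vnorm v.
Proof.
have [v0|v0] := eqVneq (vnorm v) 0.
  by rewrite v0 mulr0 (vnorm_eq0 v0) mulmx0 -(vnorm_eq0 v0) v0.
have vp : 0 < vnorm v by rewrite lt_def v0 vnorm_ge0.
rewrite -ler_pdivrMr //.
have -> : vnorm (A *m v) / vnorm v = vnorm (A *m ((vnorm v)^-1%:C%C *: v)).
  by rewrite -scalemxAr vnorm_scale ?invr_ge0 ?vnorm_ge0 // mulrC.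
apply: sup_upper_bound; first exact: opnorm_has_sup.
exists ((vnorm v)^-1%:C%C *: v) => //=.
by rewrite vnorm_scale ?invr_ge0 ?vnorm_ge0 // mulVf.
Qed.

Lemma opnorm_le (R : realType) n (A : 'M[R[i]]_n) (c : R) :
  0 <= c -> (forall v, vnorm (A *m v) <= c * vnorm v) -> opnorm A <= c.
Proof.
move=> c0 Ac; apply: ge_sup; first by have [] := opnorm_has_sup A.
move=> _ [v /= v1 <-]; apply: le_trans (Ac v) _.
by rewrite ler_piMr.
Qed.

Lemma opnormM (R : realType) n (A B : 'M[R[i]]_n) :
  opnorm (A *m B) <= opnorm A * opnorm B.
Proof.
apply: opnorm_le => [|v]; first by rewrite mulr_ge0 ?opnorm_ge0.
rewrite -mulmxA -mulrA; apply: le_trans (vnorm_mulmx_le _ _) _.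
by rewrite ler_wpM2l ?opnorm_ge0 ?vnorm_mulmx_le.
Qed.

(** Pythagoras: the squared norm of [v] is the sum of those of its components in the range of [P]
    and of [1%:M - P]. *)
Lemma opnorm_compl_projection (R : realType) n (P : 'M[R[i]]_n) :
  P *m P = P -> P^t* = P -> opnorm (1%:M - P) <= 1.
Proof.
move=> PP hP; apply: opnorm_le => // v; rewrite mul1r.
rewrite -(ler_pXn2r (n := 2)) ?nnegrE ?vnorm_ge0 //.
rewrite -lecR !vnorm_dot.
have -> : v^t* *m v = (P *m v)^t* *m (P *m v)
    + ((1%:M - P) *m v)^t* *m ((1%:M - P) *m v).
  have hQ : (1%:M - P)^t* = 1%:M - P.
    by rewrite raddfB /= map_mxB hP trmx1 map_mx1.
  have QQ : (1%:M - P) *m (1%:M - P) = 1%:M - P.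
    by rewrite mulmxBr mulmx1 mulmxBl PP mul1mx subrr subr0.
  rewrite !trmx_mul !map_mxM hP hQ -!mulmxA (mulmxA P) (mulmxA (1%:M - P)) PP QQ.
  by rewrite -mulmxDr -mulmxDl subrKC mul1mx.
by rewrite [leRHS]mxE lerDr -vnorm_dot ler0c sqr_ge0.
Qed.

(** The entry is a coordinate of the image of a unit vector. This serves both for the eigenvalues of
    a perturbation and for expectations in a density matrix. *)
Lemma cabs_diag_conj_le (R : realType) n (U M : 'M[R[i]]_n) i :
  U \is unitarymx -> cabs ((U *m M *m U^t*) i i) <= opnorm M.
Proof.
move=> uU; pose e : 'cV[R[i]]_n := delta_mx i 0.
have -> : (U *m M *m U^t*) i i = (U *m (M *m (U^t* *m e))) i 0.
  by rewrite !mulmxA -colE [RHS]mxE.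
apply: le_trans (cabs_le_vnorm _ _) _.
rewrite vnorm_unitary //; apply: le_trans (vnorm_mulmx_le _ _) _.
rewrite vnorm_unitary ?trmxC_unitary // ler_piMr ?opnorm_ge0 //.
rewrite -(ler_pXn2r (n := 2)) ?nnegrE ?vnorm_ge0 // sqr_vnorm expr1n.
rewrite (bigD1 i) //= big1 ?addr0 => [|j ji].
  rewrite mxE !eqxx (_ : cabs _ = 1) ?expr1n //.
  by apply: complexI; rewrite cabsE normr1.
rewrite mxE (negPf ji) (_ : cabs _ = 0) ?expr0n //.
by apply: complexI; rewrite cabsE normr0.
Qed.

(** In an eigenbasis of [rho] the trace is a convex combination of diagonal entries of [M]. *)
Lemma cabs_trace_density_le (R : realType) n (rho M : 'M[R[i]]_n) :
  density rho -> cabs (\tr (rho *m M)) <= opnorm M.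
Proof.
move=> [[hrho prho] trho]; rewrite /selfadj adjmxE in hrho.
have [U [a [_ [uU erho _]]]] := hermitian_codiagonalization hrho hrho erefl.
have a_ge0 i : 0 <= a 0 i.
  have := prho (U^t* *m delta_mx i 0).
  rewrite adjmxE trmx_mul map_mxM trmxCK trmx_delta map_delta_mx erho !mulmxA.
  rewrite mulmxtVK // mulmxtVK // -colE mxE -rowE mxE.
  by rewrite !mxE eqxx.
have tra : \sum_i a 0 i = 1.
  by rewrite -trho erho mxtrace_mulC mulmxA (unitarymxP uU) mul1mx mxtrace_diag.
have -> : \tr (rho *m M) = \sum_i a 0 i * (U *m M *m U^t*) i i.
  rewrite erho -!mulmxA mxtrace_mulC -!mulmxA mul_diag_mx.
  by apply: eq_bigr => i _; rewrite mxE !mulmxA.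
apply: le_trans (ler_cabs_sum _ _ _) _.
have -> : opnorm M = \sum_i cabs (a 0 i) * opnorm M.
  rewrite -mulr_suml (_ : \sum_i _ = 1) ?mul1r //; apply: complexI.
  rewrite rmorph_sum [RHS]rmorph1 -tra; apply: eq_bigr => i _.
  by rewrite /= cabsE ger0_norm.
apply: ler_sum => i _; rewrite cabsM ler_wpM2l ?cabs_ge0 //.
exact: cabs_diag_conj_le.
Qed.

(** [rho] is itself a positive square root of [adjmx rho *m rho], so its trace 1 lies in the set
    whose supremum is taken; it remains to bound that set. *)
Lemma trnorm_density_ge1 (R : realType) n (rho : 'M[R[i]]_n) :
  density rho -> 1 <= trnorm rho.
Proof.
move=> [prho trho].
have -> : 1 = complex.Re (\tr rho) by rewrite trho.
apply: ub_le_sup; last by exists rho => //=; split=> //; have [-> _] := prho.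
(* A diagonal entry of a self-adjoint [S] is at most the norm of its column, whose square is the
   diagonal entry of [S *m S]; the bound is therefore the same for all [S]. *)
exists (\sum_k Num.sqrt (complex.Re ((adjmx rho *m rho) k k))) => _ [S [[hS _] SS] <-].
rewrite /mxtrace raddf_sum /=; apply: ler_sum => k _.
apply: le_trans (ler_norm _) _; rewrite -sqrtr_sqr; apply: ler_wsqrtr.
have -> : (adjmx rho *m rho) k k = \sum_j (cabs (S j k) ^+ 2)%:C%C.
  rewrite -SS -{1}hS mxE; apply: eq_bigr => j _.
  by rewrite !mxE mulrC -normCK -cabsE rmorphXn.
rewrite raddf_sum (bigD1 k) //= /cabs sqr_sqrtr ?addr_ge0 ?sqr_ge0 //.
by rewrite -addrA lerDl addr_ge0 ?sqr_ge0 // sumr_ge0 // => j _; exact: sqr_ge0.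
Qed.

(** * Locality and exact vanishing of the cross terms *)

(** Only one intermediate configuration contributes: it must agree with [cfg i] off [X] and with
    [cfg j] off [Y], hence with [cfg j] on [X]. *)
Lemma local_mulmxE (R : realType) (T : finType) q (X Y : {set T}) (A B : op R T q)
    (f g : conf T q -> conf T q -> R[i]) :
  [disjoint X & Y] ->
  (forall s t s' t' : conf T q,
      {in X, s =1 s'} -> {in X, t =1 t'} -> f s t = f s' t') ->
  (forall s t s' t' : conf T q,
      {in Y, s =1 s'} -> {in Y, t =1 t'} -> g s t = g s' t') ->
  (forall i j, A i j = if [forall x in ~: X, cfg i x == cfg j x]
                       then f (cfg i) (cfg j) else 0) ->
  (forall i j, B i j = if [forall x in ~: Y, cfg i x == cfg j x]
                       then g (cfg i) (cfg j) else 0) ->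
  forall i j, (A *m B) i j =
    if [forall x in ~: (X :|: Y), cfg i x == cfg j x]
    then f (cfg i) (cfg j) * g (cfg i) (cfg j) else 0.
Proof.
move=> dXY fX gY eA eB i j; rewrite mxE.
pose c : conf T q := [ffun x => if x \in X then cfg j x else cfg i x].
pose k0 : 'I_(dimH T q) := enum_rank c.
have ck : cfg k0 = c by rewrite /cfg enum_rankK.
have XnY x : x \in Y -> x \notin X by move=> xY; rewrite (disjointFl dXY).
have A0 k : k != k0 -> A i k * B k j = 0.
  move=> kk0; rewrite eA eB.
  case: ifPn => [/forall_inP ik|]; last by rewrite mul0r.
  case: ifPn => [/forall_inP kj|]; last by rewrite mulr0.
  case/negP: kk0; apply/eqP/enum_val_inj; rewrite -/(cfg _) -/(cfg _) ck.
  apply/ffunP => x; rewrite ffunE; case: ifPn => xX.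
    by apply/eqP; apply: kj; rewrite inE (disjointFr dXY).
  by apply/esym/eqP; apply: ik; rewrite inE.
rewrite (bigD1 k0) //= big1 ?addr0 => [|k /A0//].
have -> : A i k0 = f (cfg i) (cfg j).
  rewrite eA ck ifT; first by apply: fX => x xX //; rewrite ffunE xX.
  by apply/forall_inP => x; rewrite inE ffunE => /negPf ->.
rewrite eB ck (_ : g c _ = g (cfg i) (cfg j)); last first.
  by apply: gY => x xY //; rewrite ffunE (negPf (XnY _ xY)).
have -> : [forall x in ~: Y, c x == cfg j x] =
    [forall x in ~: (X :|: Y), cfg i x == cfg j x].
  apply/forall_inP/forall_inP => h x.
    by rewrite !inE negb_or => /andP[/negPf xX xY]; have := h x; rewrite !inE ffunE xX; apply.
  rewrite inE ffunE => xY; case: ifPn => // xX.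
  by apply: h; rewrite !inE negb_or xX.
by case: ifP; rewrite ?mulr0.
Qed.

(** The entry formula for the product is symmetric in the two factors. *)
Lemma local_comm (R : realType) (T : finType) q (X Y : {set T}) (A B : op R T q) :
  [disjoint X & Y] -> local X A -> local Y B -> A *m B = B *m A.
Proof.
move=> dXY [f [fX eA]] [g [gY eB]]; apply/matrixP => i j.
rewrite (local_mulmxE dXY fX gY eA eB).
have dYX : [disjoint Y & X] by rewrite disjoint_sym.
by rewrite (local_mulmxE dYX gY fX eB eA) finset.setUC mulrC.
Qed.

Lemma comm_mx_sumr (R : comNzRingType) n (I : finType) (P : pred I)
    (M : 'M[R]_n) (F : I -> 'M[R]_n) :
  (forall i, P i -> M *m F i = F i *m M) ->
  M *m (\sum_(i | P i) F i) = (\sum_(i | P i) F i) *m M.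
Proof. by move=> h; rewrite mulmx_sumr mulmx_suml; apply: eq_bigr. Qed.

(** In the eigenbasis of [H], [P0] fixes the basis vectors of eigenvalue [E0], and its rows at other
    eigenvalues vanish because its range consists of eigenvectors for [E0]. Hermitian symmetry gives
    the remaining entries. *)
Lemma spec_proj_diag (R : realType) n (H P0 U : 'M[R[i]]_n) (h : 'rV[R[i]]_n) (E0 : R) :
  spec_proj H E0 P0 -> U \is unitarymx -> H = U^t* *m diag_mx h *m U ->
  P0 = U^t* *m diag_mx (\row_i (h 0 i == E0%:C%C)%:R) *m U.
Proof.
move=> [PP [hP PE]] uU eH; rewrite /selfadj adjmxE in hP.
have UU : U^t* *m U = 1%:M by apply/mulmx1C/unitarymxP.
pose N := U *m P0 *m U^t*.
have Ncol i j : N i j = (U *m (P0 *m (U^t* *m delta_mx j 0))) i (0 : 'I_1).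
  by rewrite !mulmxA -colE [RHS]mxE.
have Nlow i j : h 0 j = E0%:C%C -> N i j = (i == j)%:R.
  move=> hj; rewrite Ncol (_ : P0 *m _ = U^t* *m delta_mx j 0).
    by rewrite mulmxA (unitarymxP uU) mul1mx mxE eqxx andbT.
  apply/PE; rewrite eH -!mulmxA (mulmxA U) (unitarymxP uU) mul1mx scalemxAr.
  congr (_ *m _); apply/matrixP => a b; rewrite mul_diag_mx !mxE.
  by case: eqVneq => [->|]; rewrite ?hj // !mulr0.
have Nhigh i j : h 0 i != E0%:C%C -> N i j = 0.
  move=> hi; rewrite Ncol; set w := P0 *m _.
  have /PE : P0 *m w = w by rewrite mulmxA PP.
  clearbody w; rewrite eH -!mulmxA => /(congr1 (mulmx U)).
  rewrite mulmxA (unitarymxP uU) mul1mx -scalemxAr mul_diag_mx.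
  move=> /matrixP/(_ i 0); rewrite mxE [RHS]mxE.
  move=> /eqP; rewrite -subr_eq0 -mulrBl mulf_eq0 subr_eq0 (negPf hi) /=.
  by move/eqP.
have hN : N^t* = N by rewrite /N !trmx_mul !map_mxM trmxCK hP mulmxA.
have eN : P0 = U^t* *m N *m U.
  by rewrite /N !mulmxA UU mul1mx -mulmxA UU mulmx1.
suff Nd : N = diag_mx (\row_i (h 0 i == E0%:C%C)%:R) by rewrite eN Nd.
apply/matrixP => i j; rewrite [RHS]mxE [X in _ = X *+ _]mxE.
have [hi|hi] := eqVneq (h 0 i) E0%:C%C; last by rewrite Nhigh // mul0rn.
have /matrixP/(_ i j) <- := hN; rewrite 2!mxE Nlow // eq_sym.
by rewrite conjC_nat; case: (i == j).
Qed.

Lemma gapped_diag (R : realType) n (H U : 'M[R[i]]_n) (h : 'rV[R[i]]_n) (E0 g : R) i :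
  gapped H E0 g -> U \is unitarymx -> H = U^t* *m diag_mx h *m U ->
  h 0 i != E0%:C%C -> E0 + g <= complex.Re (h 0 i).
Proof.
move=> [_ gap] uU eH hi.
have ev : eigenvalue H (h 0 i).
  apply/eigenvalueP; exists (row i U).
    rewrite -row_mul eH !mulmxA (unitarymxP uU) mul1mx mul_diag_mx.
    by apply/rowP => j; rewrite !mxE.
  apply/eqP => ri; have := congr1 (fun M : 'M_n => M i i) (unitarymxP uU).
  rewrite mxE big1 => [|j _]; last by move/rowP/(_ j): ri; rewrite !mxE => ->; rewrite mul0r.
  by move/esym/eqP; rewrite mxE eqxx oner_eq0.
(* The order on complex numbers forces equal imaginary parts, so the modulus in [gapped] is a
   difference of real parts. *)
have [] := gap _ ev hi; rewrite ltcE => /andP[].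
case: (h 0 i) => a b /= /eqP -> ltE; rewrite /cabs /= subrr expr0n addr0 sqrtr_sqr.
rewrite ger0_norm; first by rewrite lerBrDl.
by rewrite subr_ge0 ltW.
Qed.

Lemma ground_state_cross_terms (R : realType) (T : finType) q
    (Psi : {set T} -> op R T q) (E0 g : R) (P0 rho : op R T q)
    (X Y : {set T}) (A B : op R T q) :
  interaction Psi -> commuting Psi -> gapped (hamiltonian Psi) E0 g ->
  spec_proj (hamiltonian Psi) E0 P0 -> ground_state P0 rho ->
  [disjoint X & Y] -> local X A -> local Y B ->
  4 * \sum_(Z : {set T} | ~~ [disjoint Z & X] && ~~ [disjoint Z & Y]) opnorm (Psi Z) < g ->
  \tr (rho *m A *m (1%:M - P0) *m B) + \tr (rho *m B *m (1%:M - P0) *m A) = 0.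
Proof.
move=> iPsi cPsi gap sp [_ erho] dXY lA lB.
set W := \sum_(Z | _) _ => Wg.
pose mX (Z : {set T}) := ~~ [disjoint Z & X].
pose mY (Z : {set T}) := ~~ [disjoint Z & Y].
(* [G + L] is the Hamiltonian without the crossing terms; [L] commutes with [A] and [G] with [B], as
   [frequency_filter] requires. *)
pose V := \sum_(Z | mX Z && mY Z) Psi Z.
pose G := \sum_(Z | mX Z && ~~ mY Z) Psi Z.
pose L := \sum_(Z | ~~ mX Z) Psi Z.
have eH : hamiltonian Psi = G + L + V.
  by rewrite /hamiltonian (bigID mX) /= (bigID mY) /= -/V -/G -/L -addrA addrC.
have cP (P Q : pred {set T}) : (\sum_(Z | P Z) Psi Z) *m (\sum_(Z | Q Z) Psi Z) =
    (\sum_(Z | Q Z) Psi Z) *m (\sum_(Z | P Z) Psi Z).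
  apply: comm_mx_sumr => Z _; apply/esym/comm_mx_sumr => Z' _; exact: cPsi.
have hP (P : pred {set T}) : (\sum_(Z | P Z) Psi Z)^t* = \sum_(Z | P Z) Psi Z.
  rewrite raddf_sum /= map_mx_sum; apply: eq_bigr => Z _.
  by rewrite -adjmxE; have [] := iPsi Z.
have LA : L *m A = A *m L.
  apply/esym/comm_mx_sumr => Z; rewrite negbK => dZX.
  by apply: (local_comm _ lA (iPsi Z).2); rewrite disjoint_sym.
have BG : B *m G = G *m B.
  apply/comm_mx_sumr => Z /andP[_]; rewrite negbK => dZY.
  by apply: (local_comm _ lB (iPsi Z).2); rewrite disjoint_sym.
have BA : B *m A = A *m B by apply: local_comm lB lA; rewrite disjoint_sym.
have hK : (G + L)^t* = G + L by rewrite raddfD /= map_mxD !hP.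
have KV : (G + L) *m V = V *m (G + L) by rewrite mulmxDl mulmxDr !(cP _ (fun Z => mX Z && mY Z)).
(* In this common eigenbasis [H] has the eigenvalues [k + v], so those of [G + L] differ from them
   only by [v]. *)
have [U [k [v [uU eK eV]]]] := hermitian_codiagonalization hK (hP _) KV.
have UU : U^t* *m U = 1%:M by apply/mulmx1C/unitarymxP.
rewrite -/V in eV.
have eHd : hamiltonian Psi = U^t* *m diag_mx (k + v) *m U.
  by rewrite eH eK {1}eV raddfD /= mulmxDr mulmxDl.
have eP := spec_proj_diag sp uU eHd.
have vW i : `|complex.Re (v 0 i)| <= W.
  have -> : v 0 i = \sum_(Z | mX Z && mY Z) (U *m Psi Z *m U^t*) i i.
    rewrite -summxE -mulmx_suml -mulmx_sumr -/V eV !mulmxA (unitarymxP uU) mul1mx.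
    by rewrite -mulmxA (unitarymxP uU) mulmx1 !mxE eqxx.
  rewrite raddf_sum; apply: le_trans (ler_norm_sum _ _ _) _; apply: ler_sum => Z _.
  apply: le_trans (cabs_diag_conj_le (Psi Z) i uU).
  by rewrite -sqrtr_sqr; apply: ler_wsqrtr; rewrite lerDl sqr_ge0.
(* The sign of the real part, cut off at half the gap, is interpolated on the finitely many
   differences of eigenvalues of [G + L]. *)
pose phi (z : R[i]) : R[i] := if g / 2 <= complex.Re z then 1 else
  if complex.Re z <= - (g / 2) then -1 else 0.
have [p ep] := poly_interpolation [seq k 0 ij.1 - k 0 ij.2 | ij : 'I__ * 'I__] phi.
have GL : G + L - L = G by rewrite addrK.
have LK : L *m (G + L) = (G + L) *m L by rewrite mulmxDl mulmxDr [L *m G]cP.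
have [|M [BM eM]] := frequency_filter p uU eK LA BA LK; first by rewrite GL.
pose low i := (k + v) 0 i == E0%:C%C.
have lowE i : low i -> complex.Re (k 0 i) = E0 - complex.Re (v 0 i).
  by rewrite /low mxE => /eqP/(congr1 (@complex.Re R)); rewrite raddfD /= => <-; rewrite addrK.
have highE i : ~~ low i -> E0 + g - complex.Re (v 0 i) <= complex.Re (k 0 i).
  by move=> /(gapped_diag gap uU eHd); rewrite mxE raddfD /= lerBlDr.
have vW' i : - W <= complex.Re (v 0 i) /\ complex.Re (v 0 i) <= W.
  by have := vW i; rewrite ler_norml => /andP.
apply: (clustering_of_commuting_filter (M := M) (k := k) (low := low) (phi := phi) uU) => //.
- move=> i j; rewrite eM ep //; apply/mapP; exists (i, j) => //; by rewrite mem_enum inE.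
(* Frequencies inside the band have real part at most [2 * W] in absolute value, those across it at
   least [g - 2 * W]; [4 * W < g] places [g / 2] strictly between. *)
- move=> i j /lowE li /lowE lj; rewrite /phi raddfB /= li lj.
  have [? ?] := vW' i; have [? ?] := vW' j.
  by rewrite !ifF //; apply/negbTE; rewrite -ltNge; lra.
- move=> i j /highE li /lowE lj; rewrite /phi raddfB /= lj.
  have [? ?] := vW' i; have [? ?] := vW' j.
  by rewrite ifT //; lra.
- move=> i j /lowE li /highE lj; rewrite /phi raddfB /= li.
  have [? ?] := vW' i; have [? ?] := vW' j.
  rewrite ifF; last by apply/negbTE; rewrite -ltNge; lra.
  by rewrite ifT //; lra.
Qed.

(** * Correlations and graph distance *)

(** Since [A] and [B] commute, the full correlation is the average over both orderings, and
    subtracting the [P0] terms leaves the complementary projection in each. *)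
Lemma corrE (R : realType) n (rho P0 A B : 'M[R[i]]_n) : A *m B = B *m A ->
  corr rho P0 A B = 2^-1 * cabs (\tr (rho *m A *m (1%:M - P0) *m B) +
                                 \tr (rho *m B *m (1%:M - P0) *m A)).
Proof.
move=> AB.
have -> : 2^-1 = cabs (2^-1 : R[i]).
  by apply: complexI; rewrite cabsE ger0_norm ?invr_ge0 // fmorphV rmorph_nat.
rewrite -cabsM /corr; congr cabs.
have cross (A' B' : 'M[R[i]]_n) : \tr (rho *m A' *m (1%:M - P0) *m B') =
    \tr (rho *m A' *m B') - \tr (rho *m A' *m P0 *m B').
  by rewrite mulmxBr mulmx1 mulmxBl; exact: raddfB.
rewrite !cross -(mulmxA rho B A) -AB mulmxA.
move: (\tr _) (\tr _) (\tr _) => a b c.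
have : (2 : R[i]) != 0 by rewrite pnatr_eq0.
by move=> ?; field.
Qed.

(** Each of the two cross terms is an expectation of a product of norm at most
    [opnorm A * opnorm B], and the factor [2^-1] averages them. *)
Lemma corr_le (R : realType) n (rho P0 A B : 'M[R[i]]_n) : A *m B = B *m A ->
  density rho -> P0 *m P0 = P0 -> selfadj P0 ->
  corr rho P0 A B <= opnorm A * opnorm B.
Proof.
move=> AB drho PP; rewrite /selfadj adjmxE => hP; rewrite corrE //.
suff term (A' B' : 'M[R[i]]_n) :
    cabs (\tr (rho *m A' *m (1%:M - P0) *m B')) <= opnorm A' * opnorm B'.
  rewrite ler_pdivrMl ?ltr0n // mulr_natl mulr2n.
  apply: le_trans (ler_cabsD _ _) (lerD (term A B) _).
  by rewrite [leRHS]mulrC; exact: (term B A).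
have Q1 := opnorm_compl_projection PP hP.
move: (1%:M - P0) Q1 => Q Q1.
have h1 := opnormM A' (Q *m B'); have h2 := opnormM Q B'.
have h3 := cabs_trace_density_le (A' *m (Q *m B')) drho.
have h4 : opnorm Q * opnorm B' <= opnorm B' by rewrite ler_piMl ?opnorm_ge0.
have h5 : opnorm A' * opnorm (Q *m B') <= opnorm A' * opnorm B'.
  by apply: ler_wpM2l; [exact: opnorm_ge0 | exact: le_trans h2 h4].
rewrite -2!(mulmxA rho) -(mulmxA A'); exact: le_trans h3 (le_trans h1 h5).
Qed.

(** * Interaction strength between two regions *)

Lemma normF_ge0 (R : realType) (T : finType) (e : rel T) q (F : nat -> R)
    (Psi : {set T} -> op R T q) : 0 <= normF e F Psi.
Proof. exact: bigmax_ge_id. Qed.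

Lemma sum_opnorm_le_normF (R : realType) (T : finType) (e : rel T) q (F : nat -> R)
    (Psi : {set T} -> op R T q) x y : (forall n, 0 < F n) ->
  \sum_(Z : {set T} | (x \in Z) && (y \in Z)) opnorm (Psi Z)
    <= normF e F Psi * F (gdist e x y).
Proof.
move=> F0; rewrite -ler_pdivrMr //.
by apply: (bigmax_sup x) => //; apply: (bigmax_sup y).
Qed.

(** A set meeting both [X] and [Y] contains at least one pair [x], [y], so summing over all pairs
    counts it at least once. *)
Lemma crossing_sum_le (R : realType) (T : finType) (e : rel T) q (F : nat -> R)
    (Psi : {set T} -> op R T q) (X Y : {set T}) : (forall n, 0 < F n) ->
  \sum_(Z : {set T} | ~~ [disjoint Z & X] && ~~ [disjoint Z & Y]) opnorm (Psi Z)
    <= normF e F Psi * \sum_(x in X) \sum_(y in Y) F (gdist e x y).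
Proof.
move=> F0; rewrite mulr_sumr.
apply: le_trans (_ : _ <= \sum_(x in X) \sum_(y in Y)
   \sum_(Z : {set T} | (x \in Z) && (y \in Z)) opnorm (Psi Z)) _; last first.
  apply: ler_sum => x _; rewrite mulr_sumr; apply: ler_sum => y _.
  exact: sum_opnorm_le_normF.
have -> : \sum_(x in X) \sum_(y in Y)
     \sum_(Z : {set T} | (x \in Z) && (y \in Z)) opnorm (Psi Z) =
   \sum_(Z : {set T}) \sum_(x in X) \sum_(y in Y)
     if (x \in Z) && (y \in Z) then opnorm (Psi Z) else 0.
  rewrite [RHS]exchange_big /=; apply: eq_bigr => x _.
  by rewrite [RHS]exchange_big /=; apply: eq_bigr => y _; rewrite big_mkcond.
have term_ge0 (Z : {set T}) x y : 0 <= if (x \in Z) && (y \in Z) then opnorm (Psi Z) else 0.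
  by case: ifP => // _; exact: opnorm_ge0.
rewrite [leLHS]big_mkcond /=; apply: ler_sum => Z _.
case: ifPn => [/andP[/pred0Pn[x /andP[/= xZ xX]] /pred0Pn[y /andP[/= yZ yY]]]|_].
  rewrite (bigD1 x) //= (bigD1 y) //= xZ yZ /= -addrA lerDl addr_ge0 //.
    by apply: sumr_ge0 => y' _; case: ifP => // _; exact: opnorm_ge0.
  by apply: sumr_ge0 => x' _; apply: sumr_ge0 => y' _; exact: term_ge0.
by apply: sumr_ge0 => x _; apply: sumr_ge0 => y _; exact: term_ge0.
Qed.

(** The trivial bound is paired with an upper bound on [g]: from it the decay estimates deduce that
    the factors multiplying [opnorm A * opnorm B * trnorm rho] are at least 1. *)
Lemma corr_dichotomy (R : realType) (T : finType) (e : rel T) q (F : nat -> R)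
    (Psi : {set T} -> op R T q) (E0 g : R) (P0 rho : op R T q)
    (X Y : {set T}) (A B : op R T q) :
  (forall n, 0 < F n) ->
  interaction Psi -> commuting Psi -> gapped (hamiltonian Psi) E0 g ->
  spec_proj (hamiltonian Psi) E0 P0 -> ground_state P0 rho ->
  [disjoint X & Y] -> local X A -> local Y B ->
  corr rho P0 A B = 0 \/
  corr rho P0 A B <= opnorm A * opnorm B * trnorm rho /\
    g <= 4 * (normF e F Psi * \sum_(x in X) \sum_(y in Y) F (gdist e x y)).
Proof.
move=> F0 iPsi cPsi gap sp gs dXY lA lB.
have AB := local_comm dXY lA lB.
case: (ltP (4 * \sum_(Z : {set T} | ~~ [disjoint Z & X] && ~~ [disjoint Z & Y])
  opnorm (Psi Z)) g) => [lt_g|ge_g]; [left|right].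
  rewrite corrE // (ground_state_cross_terms iPsi cPsi gap sp gs dXY lA lB lt_g).
  by rewrite (_ : cabs 0 = 0) ?mulr0 //; apply: complexI; rewrite cabsE normr0.
have [drho _] := gs; have [PP [hP _]] := sp; split.
  apply: le_trans (corr_le AB drho PP hP) _.
  by rewrite ler_peMr ?mulr_ge0 ?opnorm_ge0 // trnorm_density_ge1.
apply: le_trans ge_g _; rewrite ler_wpM2l //; exact: crossing_sum_le.
Qed.

(** * Properties of the graph distance *)

Lemma gdist_gt0 (T : finType) (e : rel T) x y : x != y -> (0 < gdist e x y)%N.
Proof.
move=> xy; rewrite /gdist; have : (0 < #|T|)%N by apply/card_gt0P; exists x.
by case: #|T| => //= n _; rewrite inE eq_sym (negPf xy).
Qed.

Lemma gdistxx (T : finType) (e : rel T) x : gdist e x x = 0.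
Proof. by rewrite /gdist; case: #|T| => //= n; rewrite inE eqxx. Qed.

Lemma gdist_le_card (T : finType) (e : rel T) x y : (gdist e x y <= #|T|)%N.
Proof. by rewrite /gdist -[leqRHS](size_iota 0) find_size. Qed.

(** [reach] extends walks at their far end; splitting a walk anywhere allows its first step to be
    peeled off, which reversing it requires. *)
Lemma reach_add (T : finType) (e : rel T) m n x y :
  (y \in reach e (m + n) x) = [exists z in reach e m x, y \in reach e n z].
Proof.
elim: n y => [|n IH] y.
  rewrite addn0; apply/idP/exists_inP => [yx|[z zx]]; first by exists y; rewrite ?inE.
  by rewrite inE => /eqP->.
rewrite addnS /= !inE IH; apply/orP/exists_inP => [[/exists_inP[z zx zy]|/exists_inP[w]]|].
- by exists z => //; rewrite !inE zy.
- rewrite IH => /exists_inP[z zx zw] wy; exists z => //.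
  by rewrite !inE; apply/orP; right; apply/exists_inP; exists w.
move=> [z zx]; rewrite !inE => /orP[zy|/exists_inP[w zw wy]].
  by left; apply/exists_inP; exists z.
right; apply/exists_inP; exists w => //; rewrite IH.
by apply/exists_inP; exists z.
Qed.

Lemma reach_sym (T : finType) (e : rel T) n x y : symmetric e ->
  (y \in reach e n x) = (x \in reach e n y).
Proof.
move=> se; elim: n x y => [|n IH] x y; first by rewrite !inE eq_sym.
rewrite -[in RHS]add1n reach_add /= !inE IH.
apply/orP/exists_inP => [[nxy|/exists_inP[w wx wy]]|[z]].
- by exists y; rewrite ?inE ?eqxx.
- exists w; last by rewrite -IH.
  by rewrite !inE; apply/orP; right; apply/exists_inP; exists y; rewrite ?inE // se.
rewrite !inE => /orP[/eqP-> ->|/exists_inP[w]]; first by left.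
rewrite inE => /eqP -> yz xz; right; apply/exists_inP; exists z; last by rewrite se.
by rewrite IH.
Qed.

Lemma gdist_sym (T : finType) (e : rel T) x y : symmetric e ->
  gdist e x y = gdist e y x.
Proof. by move=> se; apply: eq_find => n; apply: reach_sym. Qed.

Lemma bigminn_le (I : eqType) (s : seq I) (P : pred I) m (F : I -> nat) j :
  j \in s -> P j -> (\big[minn/m]_(i <- s | P i) F i <= F j)%N.
Proof.
move=> + Pj; elim: s => // i s IH; rewrite inE big_cons => /orP[/eqP<-|/IH le].
  by rewrite Pj geq_minl.
by case: ifP => // _; rewrite geq_min le orbT.
Qed.

Lemma setdist_le (T : finType) (e : rel T) (X Y : {set T}) x y :
  x \in X -> y \in Y -> (setdist e X Y <= gdist e x y)%N.
Proof.
move=> xX yY; apply: (@leq_trans (\big[minn/#|T|]_(y in Y) gdist e x y)).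
  by apply: (@bigminn_le _ _ _ _ (fun x => \big[minn/#|T|]_(y in Y) gdist e x y));
     rewrite ?mem_index_enum.
by apply: bigminn_le; rewrite ?mem_index_enum.
Qed.

(** The hypothesis on [#|T|] covers an empty [X] or [Y], for which [setdist] takes the default value
    [#|T|]. *)
Lemma setdist_gt0 (T : finType) (e : rel T) (X Y : {set T}) :
  (0 < #|T|)%N -> [disjoint X & Y] -> (0 < setdist e X Y)%N.
Proof.
move=> T0 dXY; have minn_gt0 m n : (0 < m -> 0 < n -> 0 < minn m n)%N.
  by rewrite leq_min => -> ->.
apply: (big_ind (leq 1)) => // x xX; apply: (big_ind (leq 1)) => // y yY; apply: gdist_gt0.
by apply: contraTneq xX => ->; rewrite (disjointFl dXY).
Qed.

(** * Numerical estimates for the decay functions *)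

(** The tangent bound gives 23/24 as a lower bound for the exponential at -1/24; invert it and raise
    it to the power [k]. *)
Lemma expR_le_ratio24 (R : realType) k : expR (k%:R / 24) <= (24 / 23 : R) ^+ k.
Proof.
rewrite mulrC expRM_natr; apply: lerXn2r; rewrite ?nnegrE ?expR_ge0 //; first by lra.
have := expR_ge1Dx (- 24^-1 : R); rewrite expRN => h.
rewrite -[expR _]invrK -[leRHS]invrK lef_pV2 ?posrE ?invr_gt0 ?expR_gt0 //; last by lra.
by rewrite invf_div; lra.
Qed.

Lemma ln2_ge (R : realType) : 2 / 3 <= ln 2 :> R.
Proof.
rewrite -ler_expR lnK ?posrE //.
have := expR_le_ratio24 R 16; rewrite (_ : 16 / 24 = 2 / 3); last by field.
by move/le_trans; apply; lra.
Qed.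

Lemma expR_three_halves (R : realType) : expR (3 / 2) <= 16 / 3 :> R.
Proof.
have := expR_le_ratio24 R 36; rewrite (_ : 36 / 24 = 3 / 2); last by field.
by move/le_trans; apply; lra.
Qed.

(* If the first term is too small to beat [4 * w] then [a * L ^+ 2 < 1], hence
   [a * L < 3 / 2] and the second term alone exceeds [1]. *)
Lemma log_prefactor_ge1 (R : realType) (a c L w : R) :
  0 < a -> 0 < c -> c < 4 -> 2 / 3 <= L -> 0 <= w ->
  1 <= 4 * w * expR (- (a * L)) ->
  1 <= 8 * (Num.sqrt (a / c) * w + 1) * L * expR (- (a * L)).
Proof.
move=> a0 c0 c4 L23 w0 h1.
have s0 : 0 <= Num.sqrt (a / c) := sqrtr_ge0 _.
have e0 : 0 < expR (- (a * L)) by exact: expR_gt0.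
(* In the first case [4 * w] is at most [8 * Num.sqrt (a / c) * w * L], so the first summand
   suffices. *)
case: (lerP 1 (2 * (Num.sqrt (a / c) * L))) => sL.
  apply: le_trans h1 _; rewrite ler_pM2r //.
  have : w * 1 <= w * (2 * (Num.sqrt (a / c) * L)) by rewrite ler_wpM2l.
  by nra.
have aL2 : a * L ^+ 2 < 1.
  have : (2 * (Num.sqrt (a / c) * L)) ^+ 2 < 1.
    by rewrite expr_lt1 // mulr_ge0 // mulr_ge0 //; lra.
  rewrite !exprMn sqr_sqrtr ?divr_ge0 ?ltW // => lt1.
  have : a * L ^+ 2 * 4 < c.
    have -> : a * L ^+ 2 * 4 = (2 ^+ 2 * (a / c * L ^+ 2)) * c by field; exact: lt0r_neq0.
    by rewrite -[ltRHS]mul1r ltr_pM2r.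
  lra.
have aL : a * L <= 3 / 2 by nra.
have eL : 3 / 16 <= expR (- (a * L)).
  apply: (@le_trans _ _ (expR (- (3 / 2)))); last by rewrite ler_expR lerN2.
  rewrite expRN -[3 / 16]invrK lef_pV2 ?posrE ?invr_gt0 ?expR_gt0 //; last by lra.
  by rewrite invf_div; apply: expR_three_halves.
have sw : 0 <= Num.sqrt (a / c) * w by rewrite mulr_ge0.
have L0 : 0 <= L by lra.
move: (expR _) eL e0 => E eL e0.
(* The bounds [2 / 3] on [L] and [3 / 16] on [E] multiply to [1 / 8], which the prefactor 8
   compensates exactly. *)
have LE : 1 / 8 <= L * E by nra.
have : 0 <= Num.sqrt (a / c) * w * (L * E) by rewrite mulr_ge0 // mulr_ge0 // ltW.
by move: (Num.sqrt _ * w) sw => s sw; nra.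
Qed.

(** * The two decay functions and their sums over a graph *)

Lemma F_pow_gt0 (R : realType) (a : R) n : 0 < F_pow a n.
Proof. by rewrite /F_pow powR_gt0 // ltr_wpDr. Qed.

Lemma F_powE (R : realType) (a : R) n : F_pow a n = expR (- (a * ln (1 + n%:R))).
Proof. by rewrite /F_pow /powR gt_eqF ?ltr_wpDr // mulNr. Qed.

Lemma F_pow_antitone (R : realType) (a : R) m n : 0 < a -> (m <= n)%N ->
  F_pow a n <= F_pow a m.
Proof.
move=> a0 mn; rewrite !F_powE ler_expR lerN2 ler_pM2l //.
by rewrite ler_ln ?posrE ?ltr_wpDr // lerD2l ler_nat.
Qed.

Lemma F_exp_gt0 (R : realType) (b p : R) n : 0 < F_exp b p n.
Proof. exact: expR_gt0. Qed.

Lemma F_exp_antitone (R : realType) (b p : R) m n : 0 < b -> 0 < p -> (m <= n)%N ->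
  F_exp b p n <= F_exp b p m.
Proof.
move=> b0 p0 mn; rewrite /F_exp ler_expR lerN2 ler_pM2l //.
by apply: (ge0_ler_powR (ltW p0)); rewrite ?nnegrE ?ler0n ?ler_nat.
Qed.

(** One term of the exponential series, of degree [k.+1] with [p * k.+1%:R] at least [E], already
    dominates the required power. *)
Lemma expR_powR_le_powRN (R : realType) (d p E : R) : 0 < d -> 0 < p ->
  exists2 c : R, 0 <= c & forall n, (0 < n)%N ->
    expR (- (d * n%:R `^ p)) <= c * n%:R `^ (- E).
Proof.
move=> d0 p0; pose k := Num.bound (`|E| / p).
have kE : E <= p * k.+1%:R.
  have := archi_boundP (divr_ge0 (normr_ge0 E) (ltW p0)); rewrite -/k ltr_pdivrMr //.
  move=> lt; apply: le_trans (ler_norm _) _; rewrite mulrC; apply: ltW.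
  by apply: lt_le_trans lt _; rewrite ler_pM2r // ler_nat.
exists ((k.+1)`!%:R / d ^+ k.+1); first by rewrite divr_ge0 // exprn_ge0 // ltW.
move=> n n0; have n1 : 1 <= n%:R :> R by rewrite ler1n.
have n0' : 0 < n%:R :> R by rewrite ltr0n.
set u := d * _; have u0 : 0 <= u by rewrite mulr_ge0 ?powR_ge0 ?ltW.
have f0 : 0 < (k.+1)`!%:R :> R by rewrite ltr0n fact_gt0.
rewrite expRN powRN ler_pdivlMr ?powR_gt0 // ler_pdivlMr ?exprn_gt0 //.
rewrite -mulrA mulrC ler_pdivrMr ?expR_gt0 // -ler_pdivrMl // mulrC.
have := expR_ge1Dxn k u0; apply: le_trans; apply: ler_wpDl => //.
rewrite ler_pM2r ?invr_gt0 // /u exprMn mulrC ler_pM2l ?exprn_gt0 //.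
by rewrite -powR_mulrn ?powR_ge0 // -powRrM; apply: ler_powR.
Qed.

(** Telescoping: the next inverse square is at most the decrease of [m%:R^-1]. *)
Lemma sum_inv_sqr_le2 (R : realType) m :
  \sum_(i < m) (i.+1%:R ^+ 2)^-1 <= 2 - m%:R^-1 :> R.
Proof.
elim: m => [|m IH]; first by rewrite big_ord0 invr0 subr0.
(* With the convention that 0 has inverse 0, the bound at [m = 0] is 2, too weak to yield the case
   [m = 1], which is checked directly. *)
case: m IH => [_|m IH]; first by rewrite big_ord1 expr1n invr1; lra.
rewrite big_ord_recr /=; apply: le_trans (lerD IH (lexx _)) _.
rewrite -subr_ge0.
have m1 : 0 < m.+1%:R :> R by rewrite ltr0n.
have -> : m.+2%:R = m.+1%:R + 1 :> R by rewrite -natr1.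
move: (m.+1%:R) m1 => x x0.
have -> : 2 - (x + 1)^-1 - (2 - x^-1 + ((x + 1) ^+ 2)^-1) = (x * (x + 1) ^+ 2)^-1.
  by field; rewrite !gt_eqF //; lra.
by rewrite invr_ge0 mulr_ge0 ?sqr_ge0 ?ltW.
Qed.

(** Regularity bounds the sphere of radius [n] by the ball, of order [n ^ D], so the weights leave a
    sum of inverse squares. The absolute value allows any sign of [1 + kappa]. *)
Lemma sum_gdist_powRN_le (R : realType) (T : finType) (e : rel T) (kappa D : R) x :
  kD_regular e kappa D ->
  \sum_(y | y != x) (gdist e x y)%:R `^ (- (D + 2)) <= 2 * `|1 + kappa|.
Proof.
move=> reg; pose w (n : nat) : R := n%:R `^ (- (D + 2)).
have w0 n : 0 <= w n by exact: powR_ge0.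
(* Group the vertices by distance [i.+1]; distances never exceed [#|T|]. *)
apply: (@le_trans _ _ (\sum_(i < #|T|) \sum_(y | gdist e x y == i.+1) w i.+1)).
  rewrite (exchange_big_dep (fun y => y != x)) /=; last first.
    move=> i y _; by apply: contraTneq => ->; rewrite gdistxx.
  apply: ler_sum => y yx.
  have d0 : (0 < gdist e x y)%N by apply: gdist_gt0; rewrite eq_sym.
  have dT : ((gdist e x y).-1 < #|T|)%N by rewrite prednK // gdist_le_card.
  rewrite (bigD1 (Ordinal dT)) /= ?prednK //.
  by rewrite -/(w _) lerDl; apply: sumr_ge0.
apply: (@le_trans _ _ (\sum_(i < #|T|) `|1 + kappa| * (i.+1%:R ^+ 2)^-1)).
  apply: ler_sum => i _; rewrite sumr_const -[leLHS]mulr_natl.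
  have i1 : 0 < i.+1%:R :> R by rewrite ltr0n.
  have -> : `|1 + kappa| * (i.+1%:R ^+ 2)^-1 = `|1 + kappa| * i.+1%:R `^ D * w i.+1.
    rewrite -mulrA /w -powRD; last by rewrite (gt_eqF i1) implybT.
    by rewrite (_ : D + _ = - 2%:R) ?powR_invn // ; ring.
  rewrite ler_wpM2r //; apply: le_trans (_ : _ <= (1 + kappa) * i.+1%:R `^ D) _.
    apply: le_trans (reg x i.+1 isT); rewrite ler_nat; apply: subset_leq_card.
    (* the ball in [kD_regular] elaborates to a classical set *)
    by apply/fintype.subsetP => y /eqnP yi; apply: mem_set; rewrite /= yi.
  by rewrite ler_wpM2r ?powR_ge0 ?ler_norm.
rewrite -mulr_sumr mulrC ler_wpM2r //; apply: le_trans (sum_inv_sqr_le2 _ _) _.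
by rewrite gerBl invr_ge0.
Qed.

(** Split [b] as [bt + (b - bt)]: the first part gives the decay in [r], the second makes the sum
    converge. [K] is chosen before the graph, and [x \notin S] keeps all distances positive. *)
Lemma sum_F_exp_le (R : realType) (b bt p kappa D : R) :
  0 < bt -> bt < b -> 0 < p -> exists2 K : R, 0 <= K &
  forall (T : finType) (e : rel T) x (S : {set T}) r, kD_regular e kappa D ->
    x \notin S -> (forall y, y \in S -> r <= gdist e x y)%N ->
    \sum_(y in S) F_exp b p (gdist e x y) <= K * F_exp bt p r.
Proof.
move=> bt0 btb p0.
have db : 0 < b - bt by rewrite subr_gt0.
have [c c0 cP] := expR_powR_le_powRN (D + 2) db p0.
exists (c * (2 * `|1 + kappa|)); first by rewrite !mulr_ge0.
move=> T e x S r reg xS rS.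
apply: (@le_trans _ _ (\sum_(y | y != x)
    (c * (gdist e x y)%:R `^ (- (D + 2))) * F_exp bt p r)).
  rewrite [leRHS](bigID (mem S)) /= ler_wpDr //.
    by apply: sumr_ge0 => y _; rewrite !mulr_ge0 ?powR_ge0 // ltW ?F_exp_gt0.
  rewrite [leRHS](eq_bigl (mem S)); last first.
    by move=> y /=; apply: andb_idl => yS; apply: contraNneq xS => <-.
  apply: ler_sum => y yS.
  have d0 : (0 < gdist e x y)%N.
    by apply: gdist_gt0; apply: contraNneq xS => ->.
  have -> : F_exp b p (gdist e x y) =
      expR (- ((b - bt) * (gdist e x y)%:R `^ p)) * F_exp bt p (gdist e x y).
    by rewrite /F_exp -expRD; congr expR; ring.
  apply: ler_pM; [exact: expR_ge0 | exact: ltW (F_exp_gt0 _ _ _) | exact: cP |].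
  exact: F_exp_antitone bt0 p0 (rS _ yS).
rewrite -mulr_suml -mulr_sumr ler_pM2r ?F_exp_gt0 // ler_wpM2l //.
exact: sum_gdist_powRN_le.
Qed.

(** * Clustering *)

Lemma polynomial_clustering (R : realType) (alpha : R) (T : finType) (e : rel T) q
    (Psi : {set T} -> op R T q) (E0 g : R) (P0 rho : op R T q)
    (X Y : {set T}) (A B : op R T q) :
  0 < alpha -> interaction Psi -> commuting Psi ->
  0 < g -> gapped (hamiltonian Psi) E0 g ->
  spec_proj (hamiltonian Psi) E0 P0 -> ground_state P0 rho ->
  [disjoint X & Y] -> local X A -> local Y B ->
  corr rho P0 A B <=
    8 * opnorm A * opnorm B * #|X|%:R * #|Y|%:R * trnorm rho
    * (Num.sqrt (alpha / pi) * normF e (F_pow alpha) Psi / g + 1)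
    * ln (1 + (setdist e X Y)%:R) * F_pow alpha (setdist e X Y).
Proof.
move=> a0 iPsi cPsi g0 gap sp gs dXY lA lB.
have tr0 : 0 <= trnorm rho by apply: le_trans (trnorm_density_ge1 gs.1).
set r := setdist e X Y; set N := normF _ _ _.
have N0 : 0 <= N := normF_ge0 _ _ _.
have F0 := F_pow_gt0 alpha.
have ln0 : 0 <= ln (1 + r%:R) :> R by rewrite ln_ge0 // lerDl.
pose O := opnorm A * opnorm B * trnorm rho.
have O0 : 0 <= O by rewrite !mulr_ge0 ?opnorm_ge0.
have regroup (a b x y t s w l f : R) : 8 * a * b * x * y * t * (s * w / g + 1) * l * f =
    a * b * t * (x * y) * (8 * (s * (w / g) + 1) * l * f) by ring.
rewrite regroup -/O.
have Ng0 : 0 <= N / g by rewrite divr_ge0 // ltW.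
case: (corr_dichotomy e F0 iPsi cPsi gap sp gs dXY lA lB) => [->|[leO gW]].
  have gi : 0 <= g^-1 by rewrite invr_ge0 ltW.
  have fr := ltW (F0 r).
  by rewrite !mulr_ge0 ?opnorm_ge0 // addr_ge0 // mulr_ge0 // sqrtr_ge0.
have WF : \sum_(x in X) \sum_(y in Y) F_pow alpha (gdist e x y) <=
    #|X|%:R * #|Y|%:R * F_pow alpha r.
  apply: le_trans (_ : _ <= \sum_(x in X) \sum_(y in Y) F_pow alpha r) _.
    apply: ler_sum => x xX; apply: ler_sum => y yY.
    exact: F_pow_antitone (setdist_le e xX yY).
  by rewrite !sumr_const -mulrnA -[leLHS]mulr_natl natrM [#|Y|%:R * _]mulrC.
apply: le_trans leO _; rewrite -/O -[leLHS]mulr1 -mulrA ler_wpM2l //.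
set n : R := #|X|%:R * #|Y|%:R in WF *.
have h4 : g <= 4 * (N * (n * F_pow alpha r)).
  by apply: le_trans gW _; rewrite ler_wpM2l // ler_wpM2l.
(* If [X] or [Y] were empty, [h4] would contradict [0 < g]. *)
have n1 : 1 <= n.
  have : 0 < n.
    rewrite lt_neqAle mulr_ge0 // andbT; apply: contraTneq g0 => n0.
    by rewrite -leNgt; apply: le_trans h4 _; rewrite -n0 mul0r !mulr0.
  by rewrite /n -natrM ltr0n ler1n.
(* Distance at least 1 keeps the logarithm above [ln 2], hence above [2 / 3]. *)
have r1 : (0 < r)%N.
  apply: setdist_gt0 => //; move: n1; rewrite /n -natrM ler1n muln_gt0 => /andP[X0 _].
  exact: leq_trans X0 (max_card _).
have L23 : 2 / 3 <= ln (1 + r%:R) :> R.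
  apply: le_trans (ln2_ge R) _; rewrite ler_ln ?posrE ?ltr_wpDr //.
  by rewrite -[2]/(1 + 1%:R) lerD2l ler_nat.
have nFE : 1 <= 4 * (n * (N / g)) * expR (- (alpha * ln (1 + r%:R))).
  rewrite -F_powE -(ler_pM2r g0) mul1r; apply: le_trans h4 _.
  by rewrite le_eqVlt; apply/orP; left; apply/eqP; field; exact: lt0r_neq0.
have pi4 : pi < 4 :> R by have := pihalf_lt2 R; lra.
have n0 : 0 <= n by apply: le_trans n1.
have := log_prefactor_ge1 a0 (pi_gt0 R) pi4 L23 (mulr_ge0 n0 Ng0) nFE.
rewrite -F_powE => /le_trans; apply.
set s := Num.sqrt _; set L := ln _; set f := F_pow _ _.
(* The factor [n] moves onto [N / g], matching the weight used in [nFE]; the other summand [n] is at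
   least 1. *)
have -> : n * (8 * (s * (N / g) + 1) * L * f) = 8 * (s * (n * (N / g)) + n) * L * f.
  by ring.
apply: ler_wpM2r; first exact: ltW (F0 _).
apply: ler_wpM2r; first exact: ln0.
apply: ler_wpM2l => //.
by rewrite lerD2l.
Qed.

(** The geometry enters only through the one-vertex sum bound with constant [K]; applying it from
    either side yields the minimum of the two cardinalities. *)
Lemma stretched_exponential_clustering (R : realType) (b bt p K : R)
    (T : finType) (e : rel T) q
    (Psi : {set T} -> op R T q) (E0 g : R) (P0 rho : op R T q)
    (X Y : {set T}) (A B : op R T q) :
  0 <= K ->
  (forall x (S : {set T}) r, x \notin S ->
    (forall y, y \in S -> r <= gdist e x y)%N ->
    \sum_(y in S) F_exp b p (gdist e x y) <= K * F_exp bt p r) ->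
  undirected e -> interaction Psi -> commuting Psi ->
  0 < g -> gapped (hamiltonian Psi) E0 g ->
  spec_proj (hamiltonian Psi) E0 P0 -> ground_state P0 rho ->
  [disjoint X & Y] -> local X A -> local Y B ->
  corr rho P0 A B <=
    opnorm A * opnorm B * (minn #|X| #|Y|)%:R * trnorm rho
    * (4 * K * normF e (F_exp b p) Psi / g + 1)
    * F_exp bt p (setdist e X Y).
Proof.
move=> K0 sumF se iPsi cPsi g0 gap sp gs dXY lA lB.
have tr0 : 0 <= trnorm rho by apply: le_trans (trnorm_density_ge1 gs.1).
set r := setdist e X Y; set N := normF _ _ _; set m := minn _ _.
have N0 : 0 <= N := normF_ge0 _ _ _.
have f0 : 0 < F_exp bt p r by exact: F_exp_gt0.
have h0 : 0 <= 4 * K * N / g by rewrite !mulr_ge0 // invr_ge0 ltW.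
have regroup (a c k t u f : R) : a * c * k * t * u * f = a * c * t * (k * u * f).
  by ring.
rewrite regroup.
case: (corr_dichotomy e (F_exp_gt0 b p) iPsi cPsi gap sp gs dXY lA lB) => [->|[leO gW]].
  by rewrite !mulr_ge0 ?opnorm_ge0 // ?addr_ge0 // ltW.
apply: le_trans leO _; rewrite -[leLHS]mulr1 ler_wpM2l //.
  by rewrite !mulr_ge0 ?opnorm_ge0.
have WX : \sum_(x in X) \sum_(y in Y) F_exp b p (gdist e x y) <=
    #|X|%:R * (K * F_exp bt p r).
  rewrite mulr_natl -sumr_const; apply: ler_sum => x xX; apply: sumF.
    by rewrite (disjointFr dXY xX).
  by move=> y yY; exact: setdist_le.
have WY : \sum_(x in X) \sum_(y in Y) F_exp b p (gdist e x y) <=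
    #|Y|%:R * (K * F_exp bt p r).
  rewrite exchange_big /= mulr_natl -sumr_const; apply: ler_sum => y yY.
  under eq_bigr do rewrite gdist_sym //.
  apply: sumF; first by rewrite (disjointFl dXY yY).
  by move=> x xX; rewrite gdist_sym //; exact: setdist_le.
have Wm : \sum_(x in X) \sum_(y in Y) F_exp b p (gdist e x y) <=
    m%:R * (K * F_exp bt p r) by rewrite /m; case: leqP.
(* This is the bound [gW] divided by [g]; its factor 4 is the one in the constant [4 * K]. *)
have : 1 <= m%:R * (4 * K * N / g) * F_exp bt p r.
  rewrite -(ler_pM2r g0) mul1r; apply: le_trans gW _.
  apply: (@le_trans _ _ (4 * (N * (m%:R * (K * F_exp bt p r))))).
    by rewrite ler_wpM2l // ler_wpM2l.
  move: (F_exp bt p r) => f; rewrite le_eqVlt; apply/orP; left; apply/eqP.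
  by field; exact: lt0r_neq0.
move=> /le_trans; apply; rewrite ler_pM2r // ler_wpM2l //.
by rewrite lerDl.
Qed.

Unset Implicit Arguments.

Theorem theorem4p1 (R : realType) :
  (* (a) polynomial decay *)
  (forall alpha : R, 0 < alpha ->
   forall (T : finType) (e : rel T) (q : nat) (Psi : {set T} -> op R T q)
          (E0 g : R) (P0 rho : op R T q),
     undirected e -> connected_graph e ->
     interaction Psi -> commuting Psi ->
     0 < g -> gapped (hamiltonian Psi) E0 g ->
     spec_proj (hamiltonian Psi) E0 P0 -> ground_state P0 rho ->
     forall (X Y : {set T}) (A B : op R T q),
       [disjoint X & Y] -> local X A -> local Y B ->
       corr rho P0 A B <=
         8 * opnorm A * opnorm B * #|X|%:R * #|Y|%:R * trnorm rho
         * (Num.sqrt (alpha / pi) * normF e (F_pow alpha) Psi / g + 1)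
         * ln (1 + (setdist e X Y)%:R) * F_pow alpha (setdist e X Y))
  /\
  (* (b) stretched-exponential decay on (kappa,D)-regular graphs *)
  (forall b bt p kappa D : R, 0 < bt -> bt < b -> 0 < p -> p <= 1 ->
   exists Cst : R,
   forall (T : finType) (e : rel T) (q : nat) (Psi : {set T} -> op R T q)
          (E0 g : R) (P0 rho : op R T q),
     undirected e -> connected_graph e -> kD_regular e kappa D ->
     interaction Psi -> commuting Psi ->
     0 < g -> gapped (hamiltonian Psi) E0 g ->
     spec_proj (hamiltonian Psi) E0 P0 -> ground_state P0 rho ->
     forall (X Y : {set T}) (A B : op R T q),
       [disjoint X & Y] -> local X A -> local Y B ->
       corr rho P0 A B <=
         opnorm A * opnorm B * (minn #|X| #|Y|)%:R * trnorm rho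
         * (Cst * normF e (F_exp b p) Psi / g + 1)
         * F_exp bt p (setdist e X Y)).
Proof.
split=> [alpha a0 T e q Psi E0 g P0 rho _ _ iPsi cPsi g0 gap sp gs X Y A B|].
  exact: (polynomial_clustering e a0 iPsi cPsi g0 gap sp gs).
move=> b bt p kappa D bt0 btb p0 _.
(* [K] depends only on [b], [bt], [p], [kappa] and [D], so the constant is uniform in the graph and
   the interaction. *)
have [K K0 sumF] := sum_F_exp_le kappa D bt0 btb p0; exists (4 * K).
move=> T e q Psi E0 g P0 rho se _ reg iPsi cPsi g0 gap sp gs X Y A B.
apply: (stretched_exponential_clustering K0 _ se iPsi cPsi g0 gap sp gs).
by move=> x S r; exact: sumF.
Qed.
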